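(* For every integer $n\ge 0$ there is a bijection between the set $\mathcal{O}(\mathrm{LPF}_n)$ of outcomes of Lehmer parking functions of length $n$ and the set of set partitions of $[n]$.
   Context: Let $[n]=\{1,\ldots,n\}$. A Lehmer parking function of length $n$ is a tuple $\alpha=(a_1,\ldots,a_n)\in[n]^n$ with $a_i\le n-i+1$ for all $i\in[n]$; $\mathrm{LPF}_n$ is the set of these. Cars $1,2,\ldots,n$ arrive in this order on a one-way street with spots $1,\ldots,n$; car $i$ parks in the first empty spot at or after its preference $a_i$. A tuple is a parking function if all cars park; every Lehmer parking function is a parking function. The outcome $\mathcal{O}(\alpha)$ is the permutation $\pi=\pi_1\cdots\pi_n$ of $[n]$ where $\pi_i=j$ means that spot $i$ is occupied by car $j$ at the end. $\mathcal{O}(\mathrm{LPF}_n)=\{\mathcal{O}(\alpha):\alpha\in\mathrm{LPF}_n\}$. A set partition of $[n]$ is a set of nonempty pairwise disjoint subsets (blocks) of $[n]$ whose union is $[n]$. For $n=0$, the only Lehmer parking function is the empty tuple, with outcome the empty permutation, and the only set partition of $\emptyset$ is the empty one. *)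

(* Defs.v *)
From mathcomp Require Import all_boot all_fingroup.

Set Implicit Arguments.
Unset Strict Implicit.
Unset Printing Implicit Defensive.

(* The set [n] = {1, ..., n} of cars and of spots is represented by 'I_n, the
   ordinal of value k standing for k + 1. *)

(* For [s : street n], [s j] is [Some i] if car i occupies spot j,
   and [None] if spot j is empty. *)
Definition street (n : nat) := {ffun 'I_n -> option 'I_n}.

Definition empty_street (n : nat) : street n := [ffun=> None].

Definition first_empty_spot (n : nat) (s : street n) (a : 'I_n) : option 'I_n :=
  [pick j : 'I_n | [&& a <= j, s j == None &
                       [forall k : 'I_n, (a <= k < j) ==> (s k != None)]]].

(* A car that finds no empty spot leaves the street. *)
Definition park (n : nat) (alpha : {ffun 'I_n -> 'I_n}) (s : street n)
    (i : 'I_n) : street n :=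
  if first_empty_spot s (alpha i) is Some j
  then [ffun k => if k == j then Some i else s k]
  else s.

(* [enum 'I_n] is increasing: the cars arrive in the order 1, ..., n. *)
Definition final_street (n : nat) (alpha : {ffun 'I_n -> 'I_n}) : street n :=
  foldl (park alpha) (empty_street n) (enum 'I_n).

(* [sigma j = i] when spot j is finally occupied by car i; such a [sigma] exists
   exactly when all the cars park, and is then unique. *)
Definition is_outcome (n : nat) (alpha : {ffun 'I_n -> 'I_n}) (sigma : 'S_n) : bool :=
  [forall j : 'I_n, final_street alpha j == Some (sigma j)].

(* With values and indices starting from 0, a_i <= n - i + 1 reads
   alpha i + 1 <= n - (i + 1) + 1; the subtraction is never truncated. *)
Definition LPF (n : nat) : {set {ffun 'I_n -> 'I_n}} :=
  [set alpha : {ffun 'I_n -> 'I_n} | [forall i : 'I_n, alpha i < n - i]].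

Definition LPF_outcomes (n : nat) : {set 'S_n} :=
  [set sigma : 'S_n | [exists alpha in LPF n, is_outcome alpha sigma]].

Definition set_partitions (n : nat) : {set {set {set 'I_n}}} :=
  [set P : {set {set 'I_n}} | partition P [set: 'I_n]].

(* Main.v *)
Require Import Defs.
From mathcomp Require Import all_boot all_fingroup.
From mathcomp Require Import zify.

Set Implicit Arguments.
Unset Strict Implicit.
Unset Printing Implicit Defensive.

(** Number the cars from the last to the first: let pi v be the spot of the car
    n - 1 - v.  A car can come to rest at spot p exactly from
    those preferences a <= p for which all the spots from a to p - 1 already hold
    earlier cars.  The Lehmer condition bounds the preference of that car by v, and
    larger preferences are easier to fulfil, so sigma is an outcome if and only
    if every spot k with v <= k < pi v holds an earlier car.  In terms of pi:
    there are no u < v <= pi u < pi v, which says that the upper arcs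
    u -> pi u >= u of the permutation pi do not cross
    ([LPF_outcomes_noncrossing]).

    Such a pi is determined by its lower arcs v -> pi v < v, and these are
    arbitrary.  Lower arcs form a decreasing partial injection g.  Its sources and
    its targets being known, so are the sources and the targets of the upper arcs,
    and there is only one noncrossing way to join these
    ([antiexc_noncrossing_inj]).  Conversely, among the permutations whose lower
    arcs all belong to g, one that minimises the sum of the v * pi v has no
    crossing and has all of g as its lower arcs, since otherwise exchanging two
    values would decrease the sum ([antiexc_noncrossing_surj]).

    Finally, decreasing partial injections are the arc diagrams of set
    partitions: g sends each element to the preceding element of its block
    ([partition_of_inj], [block_pred_partition]). *)

(** * The outcome of a parking process *)

Definition street_at (n : nat) (alpha : {ffun 'I_n -> 'I_n}) (m : nat) :
    street n :=
  foldl (park alpha) (empty_street n) (take m (enum 'I_n)).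

Lemma street_at_full n (alpha : {ffun 'I_n -> 'I_n}) :
  street_at alpha n = final_street alpha.
Proof. by rewrite /street_at take_oversize ?size_enum_ord. Qed.

Lemma street_atS n (alpha : {ffun 'I_n -> 'I_n}) (i : 'I_n) :
  street_at alpha i.+1 = park alpha (street_at alpha i) i.
Proof.
by rewrite /street_at (take_nth i) ?size_enum_ord // foldl_rcons nth_ord_enum.
Qed.

Lemma first_empty_spotP n (s : street n) (a j : 'I_n) :
  reflect [/\ a <= j, s j = None & forall k : 'I_n, a <= k < j -> s k != None]
          (first_empty_spot s a == Some j).
Proof.
rewrite /first_empty_spot; case: pickP => [l|none].
  case/and3P=> al /eqP sl /forallP ltl.
  apply: (iffP eqP) => [[<-]|[aj sj ltj]].
    by split=> // k kP; apply: (implyP (ltl k)).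
  congr Some; apply/val_inj/eqP; case: ltngtP => // [lj|jl].
    by move: (ltj l); rewrite al lj sl => /(_ isT).
  by move: (implyP (ltl j)); rewrite aj jl sj => /(_ isT).
apply: (iffP eqP) => // -[aj sj ltj]; move: (none j).
rewrite aj sj eqxx /= => /negP[]; apply/forallP => k; apply/implyP; exact: ltj.
Qed.

Lemma street_at_mono n (alpha : {ffun 'I_n -> 'I_n}) (m l : nat) (j i : 'I_n) :
  m <= l <= n -> street_at alpha m j = Some i -> street_at alpha l j = Some i.
Proof.
case/andP; elim: l => [|l IHl]; first by rewrite leqn0 => /eqP ->.
rewrite leq_eqVlt => /predU1P[-> //|/IHl{}IHl ltln /IHl{}IHl].
rewrite (street_atS alpha (Ordinal ltln)) /park /=.
have sj := IHl (ltnW ltln).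
case E: first_empty_spot => [k|//]; rewrite ffunE; case: eqP => // jk.
by move/eqP/first_empty_spotP: E => [_]; rewrite -jk sj.
Qed.

Lemma parked_first_empty n (alpha : {ffun 'I_n -> 'I_n}) (m : nat)
    (j i : 'I_n) :
  m <= n -> street_at alpha m j = Some i ->
  i < m /\ first_empty_spot (street_at alpha i) (alpha i) = Some j.
Proof.
elim: m => [|m IHm] ltmn; first by rewrite /street_at take0 ffunE.
have {}IHm : street_at alpha m j = Some i ->
    i < m.+1 /\ first_empty_spot (street_at alpha i) (alpha i) = Some j.
  by case/(IHm (ltnW ltmn)) => ltim; split=> //; apply: ltnW.
rewrite (street_atS alpha (Ordinal ltmn)) /park /=.
case E: first_empty_spot => [k|//]; rewrite ffunE; case: eqP => // -> [<-].
by split.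
Qed.

(** A car that ends at spot p found the spots from its preference up to p - 1
    occupied, hence by earlier cars; as no car moves after parking, these are also
    the final occupants of those spots.  Conversely, under this condition an
    induction on time shows that the street holds, at each moment, exactly the part
    of sigma made of the cars that have arrived. *)
Lemma is_outcomeP n (alpha : {ffun 'I_n -> 'I_n}) (sigma : 'S_n) :
  reflect (forall p : 'I_n, alpha (sigma p) <= p /\
             forall k : 'I_n, alpha (sigma p) <= k < p -> sigma k < sigma p)
          (is_outcome alpha sigma).
Proof.
apply: (iffP forallP) => [out p|cond].
  have final k : street_at alpha n k = Some (sigma k).
    by rewrite street_at_full; apply/eqP.
  have [_ /eqP/first_empty_spotP[ap _ full]] :=
    parked_first_empty (leqnn n) (final p).
  split=> // k /full; case E: (street_at _ _ _) => [i|//] _.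
  have [lti _] := parked_first_empty (ltnW (ltn_ord (sigma p))) E.
  have le_n : sigma p <= n <= n by rewrite leqnn ltnW.
  by have := street_at_mono le_n E; rewrite final => -[->].
suff inv m : m <= n ->
    street_at alpha m =
    [ffun j => if sigma j < m then Some (sigma j) else None].
  by move=> j; rewrite -street_at_full inv // ffunE ltn_ord.
elim: m => [|m IHm] ltmn; first by
  apply/ffunP=> j; rewrite /street_at take0 !ffunE.
rewrite (street_atS alpha (Ordinal ltmn)) /park /= IHm; last exact: ltnW.
set i := Ordinal ltmn; have [ai full] := cond ((sigma^-1)%g i).
rewrite permKV in ai full.
have /eqP -> : first_empty_spot
    [ffun j => if sigma j < m then Some (sigma j) else None] (alpha i)
    == Some ((sigma^-1)%g i).
  apply/first_empty_spotP; split=> // [|k /full ltk].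
    by rewrite ffunE permKV /= ltnn.
  by rewrite ffunE ltk.
apply/ffunP=> j; rewrite !ffunE -(inj_eq (@perm_inj _ sigma)) permKV.
case: eqP => [->|/eqP ne]; first by rewrite ltnS leqnn.
rewrite ltnS [sigma j <= m]leq_eqVlt -[_ == m :> nat]/(sigma j == i).
by rewrite (negPf ne).
Qed.

(** With i = sigma p, the spots that must hold earlier cars are those from the
    preference up to p - 1.  The larger the preference the weaker the demand, so only
    the largest preference allowed, min(p, n - 1 - i), has to be examined. *)
Lemma LPF_outcomesP n (sigma : 'S_n) :
  reflect (forall p k : 'I_n, n <= (k + sigma p).+1 -> k < p ->
             sigma k < sigma p)
          (sigma \in LPF_outcomes n).
Proof.
rewrite inE; apply: (iffP existsP) => [[alpha /andP[]]|cond].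
  rewrite inE => /forallP lehmer /is_outcomeP out p k le_n ltkp.
  have [_ full] := out p; apply: full; rewrite ltkp andbT.
  have := lehmer (sigma p); lia.
have lt_pref (i : 'I_n) : minn ((sigma^-1)%g i) (n - i.+1) < n.
  by have := ltn_ord i; lia.
exists [ffun i => Ordinal (lt_pref i)]; apply/andP; split.
  by rewrite inE; apply/forallP => i; rewrite ffunE /=; have := ltn_ord i; lia.
apply/is_outcomeP => p; rewrite ffunE /= permK; split=> [|k lek]; first lia.
by apply: cond; lia.
Qed.

(** * Permutations without upper crossings *)

(** In the picture where each v with v <= pi v is joined to pi v by an arc drawn
    above the line, u < v <= pi u < pi v is a crossing, two arcs that only touch at
    v = pi u included.  The conclusion v < u is the negation of u < v because
    u = v is excluded by pi u < pi v. *)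
Definition noncrossing (n : nat) (pi : 'S_n) : bool :=
  [forall u, forall v : 'I_n, (v <= pi u < pi v) ==> (v < u)].

Lemma noncrossingP n (pi : 'S_n) :
  reflect (forall u v : 'I_n, v <= pi u -> pi u < pi v -> v < u)
          (noncrossing pi).
Proof.
apply: (iffP forallP) => [nc u v le lt|nc u].
  by move/forallP/(_ v)/implyP: (nc u); apply; rewrite le.
by apply/forallP=> v; apply/implyP=> /andP[]; apply: nc.
Qed.

(** Numbering the cars from the last to the first turns the Lehmer bound into
    the condition that the preference of car v is at most v. *)
Definition late_car_spot (n : nat) (sigma : 'S_n) : 'S_n :=
  (perm (@rev_ord_inj n) * sigma^-1)%g.

Lemma late_car_spot_inj n : injective (@late_car_spot n).
Proof. by move=> s t /mulgI/invg_inj. Qed.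

Lemma late_car_spot_surj n (pi : 'S_n) : exists sigma, late_car_spot sigma = pi.
Proof.
exists (pi^-1 * perm (@rev_ord_inj n))%g.
by rewrite /late_car_spot invMg invgK mulKVg.
Qed.

Lemma LPF_outcomes_noncrossing n (sigma : 'S_n) :
  (sigma \in LPF_outcomes n) = noncrossing (late_car_spot sigma).
Proof.
have sigmaK v : sigma (late_car_spot sigma v) = rev_ord v.
  by rewrite permM permKV permE.
apply/LPF_outcomesP/noncrossingP => [cond u v le lt|nc p k le lt].
  have := cond _ _ _ lt; rewrite !sigmaK /=.
  have := ltn_ord v; have := ltn_ord u; lia.
have spotE q : q = late_car_spot sigma (rev_ord (sigma q)).
  by rewrite permM (permE (@rev_ord_inj n)) rev_ordK permK.
have := nc (rev_ord (sigma k)) (rev_ord (sigma p)); rewrite -!spotE /=.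
have := ltn_ord (sigma p); have := ltn_ord (sigma k); lia.
Qed.

(** * Lower arcs of a noncrossing permutation *)

(** A partial injection that decreases, encoded as a total function: g v = v
    means that v has no image. *)
Definition decreasing_matching (n : nat) (g : 'I_n -> 'I_n) : Prop :=
  (forall v, g v <= v) /\
  (forall u v, g u < u -> g u = g v -> g v < v -> u = v).

Definition antiexc (n : nat) (pi : 'S_n) (v : 'I_n) : 'I_n :=
  if pi v < v then pi v else v.

Lemma antiexc_lt n (pi : 'S_n) (v : 'I_n) :
  (antiexc pi v < v) = (pi v < v).
Proof. by rewrite /antiexc; case: ifP; rewrite // ltnn. Qed.

Lemma antiexc_id n (pi : 'S_n) (v : 'I_n) :
  antiexc pi v < v -> antiexc pi v = pi v.
Proof. by rewrite antiexc_lt /antiexc; case: ifP. Qed.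

Lemma antiexc_matching n (pi : 'S_n) : decreasing_matching (antiexc pi).
Proof.
split=> [v|u v ltu eq_uv ltv].
  by rewrite /antiexc; case: ltnP => // /ltnW.
by apply: (@perm_inj _ pi); rewrite -(antiexc_id ltu) -(antiexc_id ltv).
Qed.

(** The values at the points with pi v >= v are recovered from the largest v
    downwards.  Suppose that pi and rho agree above v but pi v < rho v.  The point u
    with rho u = pi v is not above v, where it would be a second preimage under
    pi of the value pi v, and it is not v; so u < v <= rho u < rho v is a crossing of rho. *)
Lemma antiexc_noncrossing_inj n (pi rho : 'S_n) :
  noncrossing pi -> noncrossing rho -> antiexc pi =1 antiexc rho -> pi = rho.
Proof.
move=> ncpi ncrho eqd.
have eq_lt v : (pi v < v) = (rho v < v) by rewrite -!antiexc_lt eqd.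
have eq_desc v : pi v < v -> pi v = rho v.
  move=> lt; rewrite -antiexc_id ?antiexc_lt // eqd.
  by rewrite antiexc_id ?antiexc_lt -?eq_lt.
have absurd (s t : 'S_n) (v : 'I_n) : noncrossing t ->
    (forall w, s w < w -> s w = t w) ->
    (forall w : 'I_n, v < w -> s w = t w) -> s v < t v -> False.
  move=> /noncrossingP nct st above lt.
  have [le_v|/st eq_v] := leqP v (s v); last by rewrite eq_v ltnn in lt.
  (* The point u of the crossing is the preimage of s v under t. *)
  have := nct ((t^-1)%g (s v)) v; rewrite permKV => /(_ le_v lt) ltvu.
  have := above _ ltvu; rewrite permKV => /perm_inj eq_u.
  by rewrite eq_u ltnn in ltvu.
have eq_desc' v : rho v < v -> rho v = pi v by rewrite -eq_lt => /eq_desc.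
suff eq_from m (v : 'I_n) : n - v <= m -> pi v = rho v.
  by apply/permP=> v; apply: (eq_from n); rewrite leq_subr.
elim: m v => [|m IHm] v le_m; first by have := ltn_ord v; lia.
have above (w : 'I_n) : v < w -> pi w = rho w by move=> ltw; apply: IHm; lia.
apply/val_inj/eqP; case: ltngtP => // lt; first by case: (absurd pi rho v).
by case: (absurd rho pi v) => // w /above.
Qed.

Lemma rearrangement_lt u v a b :
  u < v -> a < b -> u * b + v * a < u * a + v * b.
Proof. nia. Qed.

(** Take a permutation of least weight, the sum of the v * pi v, among those
    whose lower arcs belong to g.  If u < v, both u and v start upper arcs, and
    pi u < pi v, then exchanging the values at u and v decreases the weight.  The
    only new lower arc that this may create is v -> pi u, so minimality excludes both
    a crossing, where v <= pi u, and a missing arc of g, where pi u = g v. *)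
Lemma antiexc_noncrossing_surj n (g : 'I_n -> 'I_n) :
  decreasing_matching g -> exists2 pi, noncrossing pi & antiexc pi =1 g.
Proof.
case=> g_le g_inj.
pose adm := [pred pi : 'S_n | [forall v, (pi v < v) ==> (pi v == g v)]].
pose weight (pi : 'S_n) := \sum_(v : 'I_n) v * pi v.
have adm1 : adm 1%g by apply/forallP=> v; rewrite perm1 ltnn.
case: (arg_minnP weight adm1) => pi /forallP adm_pi min_pi.
have admP v : pi v < v -> pi v = g v by move/(implyP (adm_pi v))/eqP.
have no_swap (u v : 'I_n) : u < v -> u <= pi u -> v <= pi v -> pi u < pi v ->
    (v <= pi u) || (pi u == g v) -> False.
  move=> ltuv leu lev lt_pi ok; pose rho := (tperm u v * pi)%g.
  have rhou : rho u = pi v by rewrite permM tpermL.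
  have rhov : rho v = pi u by rewrite permM tpermR.
  have rhoE w : w != u -> w != v -> rho w = pi w.
    by move=> wu wv; rewrite permM tpermD // eq_sym.
  have vu : v != u by rewrite -(inj_eq val_inj) neq_ltn ltuv orbT.
  have /min_pi : adm rho.
    apply/forallP=> w; apply/implyP; have [->|wu] := eqVneq w u.
      by rewrite rhou; lia.
    have [->|wv] := eqVneq w v; last by rewrite rhoE // => /admP ->.
    by rewrite rhov ltnNge; case/orP: ok => ->.
  have rest : \sum_(w : 'I_n | (w != u) && (w != v)) w * rho w =
              \sum_(w : 'I_n | (w != u) && (w != v)) w * pi w.
    by apply: eq_bigr => w /andP[wu wv]; rewrite rhoE.
  rewrite /weight (bigD1 u) //= (bigD1 v) //= [X in _ <= X](bigD1 u) //=.
  rewrite [X in _ <= _ + X](bigD1 v) //= rest rhou rhov.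
  by rewrite !addnA leq_add2r leqNgt rearrangement_lt.
exists pi.
  apply/noncrossingP=> u v le lt; rewrite ltnNge leq_eqVlt; apply/negP.
  case/predU1P=> [/val_inj uv|ltuv]; first by rewrite uv ltnn in lt.
  by apply: (no_swap u v) => //; lia.
move=> v; rewrite /antiexc; case: (ltnP (pi v) v) => [/admP //|le_v].
apply/val_inj/eqP; rewrite eqn_leq g_le andbT leqNgt; apply/negP=> lt_g.
(* Here v -> g v is missing from the lower arcs of pi.  The point u that pi
   sends to g v starts an upper arc, since otherwise u -> g v would be a second
   arc of g into g v. *)
have [u piu] : exists u, pi u = g v by exists ((pi^-1)%g (g v)); rewrite permKV.
have le_u : u <= pi u.
  rewrite leqNgt; apply/negP=> lt_u.
  have gu := admP _ lt_u.
  have uv : u = v by apply: g_inj lt_g; rewrite -gu.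
  by rewrite uv ltnNge le_v in lt_u.
have ltuv : u < v by apply: leq_ltn_trans lt_g; rewrite -piu.
apply: (no_swap u v ltuv le_u le_v); last by rewrite piu eqxx orbT.
by rewrite piu; apply: leq_trans le_v.
Qed.

(** * Decreasing matchings and set partitions *)

(** n steps suffice to reach the end of any chain v > g v > g (g v) > ... in
    'I_n; this end represents the chain. *)
Definition root (n : nat) (g : 'I_n -> 'I_n) : 'I_n -> 'I_n := iter n g.

Lemma root_fixed n (g : 'I_n -> 'I_n) (x : 'I_n) :
  (forall v, g v <= v) -> g (root g x) = root g x.
Proof.
move=> g_le; have step k : g (iter k g x) = iter k g x \/ iter k g x + k <= x.
  elim: k => [|k [IH|IH]] /=; first by right; rewrite addn0.
    by left; rewrite IH.
  have := g_le (iter k g x); rewrite leq_eqVlt => /predU1P[/val_inj eq_g|lt].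
    by left; rewrite eq_g.
  by right; lia.
by case: (step n) => //; have := ltn_ord x; lia.
Qed.

Lemma root_step n (g : 'I_n -> 'I_n) (x : 'I_n) :
  (forall v, g v <= v) -> root g (g x) = root g x.
Proof. by move=> g_le; rewrite -[RHS](root_fixed _ g_le) /root -iterSr. Qed.

Lemma root_le n (g : 'I_n -> 'I_n) (x : 'I_n) :
  (forall v, g v <= v) -> root g x <= x.
Proof.
move=> g_le; suff le k : iter k g x <= x by apply: le.
by elim: k => //= k; apply: leq_trans.
Qed.

Lemma root_min n (g : 'I_n -> 'I_n) (x : 'I_n) : g x = x -> root g x = x.
Proof. by move=> gx; apply: iter_fix. Qed.

(** Each chain of g is traversed without gaps: from y, the map g leads to the
    largest smaller element with the same root.  Suppose g y < x < y with a common
    root.  Then x is not its own root, as the root is at most g y.  By induction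
    the chain from x does not jump over g y, and by injectivity it does not enter
    g y at the next step; so g x is again strictly between g y and y, and the
    descent never stops. *)
Lemma same_root_le n (g : 'I_n -> 'I_n) (x y : 'I_n) :
  decreasing_matching g -> root g x = root g y -> x < y -> x <= g y.
Proof.
move=> [g_le g_inj].
have [m] := ubnP (x + y); elim: m x y => // m IHm x y; rewrite ltnS => le_m.
move=> eq_root ltxy; rewrite leqNgt; apply/negP=> lt_gy.
have le_gyx : g y <= g x.
  by apply: (IHm _ _ _ _ lt_gy); [lia | rewrite root_step].
have [eq_g|ne_g] := eqVneq (g x) (g y).
  have : x = y by apply: g_inj => //; rewrite ?eq_g //; lia.
  by move=> xy; rewrite xy ltnn in ltxy.
have lt_gyx : g y < g x by rewrite ltn_neqAle le_gyx eq_sym ne_g.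
have [gx|gxx] := eqVneq (g x) x.
  have := root_le (g y) g_le; rewrite root_step // -eq_root root_min //.
  by rewrite leqNgt lt_gy.
have lt_gx : g x < x by rewrite ltn_neqAle g_le gxx.
have : g x <= g y by apply: IHm; [lia | rewrite root_step | lia].
by rewrite leqNgt lt_gyx.
Qed.

Definition partition_of (n : nat) (g : 'I_n -> 'I_n) : {set {set 'I_n}} :=
  preim_partition (root g) [set: 'I_n].

Lemma pblock_partition_of n (g : 'I_n -> 'I_n) (x y : 'I_n) :
  (y \in pblock (partition_of g) x) = (root g x == root g y).
Proof.
rewrite pblock_equivalence_partition ?inE // => a b c _ _ _.
by split=> // /eqP->.
Qed.

(** By [same_root_le], g y is the predecessor of y in its block, or y itself
    when y is the least element of its block; so the blocks determine g. *)
Lemma partition_of_inj n (g h : 'I_n -> 'I_n) :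
  decreasing_matching g -> decreasing_matching h ->
  partition_of g = partition_of h -> g =1 h.
Proof.
move=> mg mh eq_gh y.
have eq_root a b : (root g a == root g b) = (root h a == root h b).
  by rewrite -!pblock_partition_of eq_gh.
have absurd (k l : 'I_n -> 'I_n) : decreasing_matching k ->
    decreasing_matching l ->
    (forall a b, (root k a == root k b) = (root l a == root l b)) ->
    k y < l y -> False.
  move=> mk ml eq_kl lt; have [k_le _] := mk; have [l_le _] := ml.
  have ltky : k y < y by apply: leq_trans lt (l_le y).
  have rl : root l (k y) = root l y by apply/eqP; rewrite -eq_kl root_step.
  have [ly|ne] := eqVneq (l y) y.
    by have := root_le (k y) l_le; rewrite rl root_min //; lia.
  have ltly : l y < y by rewrite ltn_neqAle ne l_le.
  suff : l y <= k y by rewrite leqNgt lt.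
  by apply: same_root_le ltly => //; apply/eqP; rewrite eq_kl root_step.
apply/val_inj/eqP; case: ltngtP => // lt; first by case: (absurd g h).
by case: (absurd h g) => // a b; rewrite eq_root.
Qed.

Definition block_pred (n : nat) (P : {set {set 'I_n}}) (v : 'I_n) : 'I_n :=
  if [pick x in pblock P v | x < v] is Some x0
  then [arg max_(x > x0 | (x \in pblock P v) && (x < v)) (x : nat)]
  else v.

Variant block_pred_spec n (P : {set {set 'I_n}}) (v : 'I_n) : 'I_n -> Prop :=
| BlockMin of (forall x : 'I_n, x \in pblock P v -> v <= x) :
    block_pred_spec P v v
| BlockPred (w : 'I_n) of w \in pblock P v & w < v &
    (forall x : 'I_n, x \in pblock P v -> x < v -> x <= w) :
    block_pred_spec P v w.

Lemma block_predP n (P : {set {set 'I_n}}) (v : 'I_n) :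
  block_pred_spec P v (block_pred P v).
Proof.
rewrite /block_pred; case: pickP => [x0 Px0|none]; last first.
  by left=> x Px; rewrite leqNgt; apply/negP=> lt; have := none x; rewrite Px lt.
case: arg_maxnP => // w /andP[Pw ltw] maxw; right=> // x Px ltx.
by apply: maxw; rewrite Px.
Qed.

(** Iterating the predecessor map from v leads to the least element of the block
    of v, so having the same root amounts to lying in the same block. *)
Lemma block_pred_partition n (P : {set {set 'I_n}}) :
  partition P [set: 'I_n] ->
  decreasing_matching (block_pred P) /\ partition_of (block_pred P) = P.
Proof.
move=> partP; have [/eqP covP tiP _] := and3P partP.
have sameE x y : (y \in pblock P x) = (pblock P x == pblock P y).
  by rewrite eq_pblock // covP inE.
have g_le v : block_pred P v <= v.
  by case: block_predP => // w _ /ltnW.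
have g_in v : pblock P (block_pred P v) = pblock P v.
  by case: block_predP => // w; rewrite sameE => /eqP.
have g_max v x : block_pred P v < v -> pblock P v = pblock P x -> x < v ->
    x <= block_pred P v.
  case: block_predP => [_|w _ _ maxw _ vx]; first by rewrite ltnn.
  by apply: maxw; rewrite sameE vx.
have g_inj u v : block_pred P u < u -> block_pred P u = block_pred P v ->
    block_pred P v < v -> u = v.
  move=> ltu eq_uv ltv.
  have uv : pblock P u = pblock P v by rewrite -(g_in u) eq_uv g_in.
  apply/val_inj/eqP; case: ltngtP => // lt.
    by have := g_max _ _ ltv (esym uv) lt; rewrite -eq_uv leqNgt ltu.
  by have := g_max _ _ ltu uv lt; rewrite eq_uv leqNgt ltv.
split=> //; rewrite -{2}(equivalence_partition_pblock partP).
have root_in v : pblock P (root (block_pred P) v) = pblock P v.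
  suff in_k k : pblock P (iter k (block_pred P) v) = pblock P v by apply: in_k.
  by elim: k => //= k IHk; rewrite g_in.
have root_least v x : x \in pblock P v -> root (block_pred P) v <= x.
  rewrite -root_in; have := root_fixed v g_le.
  case: (block_predP P (root _ v)) => [least _|w _ ltw _ eqw]; first exact: least.
  by rewrite eqw ltnn in ltw.
apply: eq_imset => x; apply/setP=> y; rewrite !inE sameE.
apply/eqP/eqP => [eq_r|eq_b]; first by rewrite -root_in eq_r root_in.
apply/val_inj/eqP; rewrite eqn_leq.
by rewrite !root_least // sameE root_in eq_b.
Qed.

Theorem theorem3p1 (n : nat) :
  exists f : {sigma : 'S_n | sigma \in LPF_outcomes n} ->
             {P : {set {set 'I_n}} | P \in set_partitions n},
    bijective f.
Proof.
pose F (sigma : 'S_n) := partition_of (antiexc (late_car_spot sigma)).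
have F_part sigma : F sigma \in set_partitions n.
  by rewrite inE preim_partitionP.
pose f (s : {sigma : 'S_n | sigma \in LPF_outcomes n}) :
  {P : {set {set 'I_n}} | P \in set_partitions n} :=
  exist (fun P => P \in set_partitions n) _ (F_part (val s)).
have f_inj : injective f.
  move=> [s Ls] [t Lt] [/= eqF]; apply/val_inj/late_car_spot_inj => /=.
  apply: antiexc_noncrossing_inj; rewrite -?LPF_outcomes_noncrossing //.
  by apply: partition_of_inj eqF; apply: antiexc_matching.
have f_surj P : exists s, f s == P.
  case: P => P PP; have := PP; rewrite inE => /block_pred_partition[mg partE].
  have [pi nc eq_pi] := antiexc_noncrossing_surj mg.
  have [sigma def_pi] := late_car_spot_surj pi.
  have Ls : sigma \in LPF_outcomes n by rewrite LPF_outcomes_noncrossing def_pi.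
  exists (exist (fun s => s \in LPF_outcomes n) sigma Ls).
  apply/eqP/val_inj; rewrite /= /F def_pi -[RHS]partE.
  apply: eq_imset => x; apply/setP=> y; rewrite !inE.
  by rewrite /root !(eq_iter eq_pi).
exists f; exists (fun P => xchoose (f_surj P)) => [s|P].
  by apply: f_inj; apply/eqP; apply: xchooseP (f_surj (f s)).
exact/eqP/(xchooseP (f_surj P)).
Qed.
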